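(* Let $U\subseteq\mathbb{R}^n$ be a star-shaped open set, let $\omega\in\Omega^1(U)$ be a nowhere-vanishing 1-form on $U$ which is Frobenius integrable, i.e. $d\omega\wedge\omega=0$, and let $\mathcal{Z}=\mathcal{S}(\{\omega\})^{\perp}$ be the associated corank 1 involutive distribution of all smooth vector fields $Z$ on $U$ with $Z\,\lrcorner\,\omega=0$. Let $X$ be a $\mathcal{C}^{\infty}$-symmetry of $\mathcal{Z}$. Then a non-vanishing smooth function $f$ on $U$ is a symmetrizing factor for $X$ with respect to $\mathcal{Z}$ if and only if $\mu=1/(fX\,\lrcorner\,\omega)$ is an integrating factor for $\omega$.
   Context: $\lrcorner$ denotes contraction (interior product) of a vector field with a differential form. Vector fields (or 1-forms) are called independent on $U$ if they are pointwise linearly independent at every point of $U$. $\mathcal{S}(B)$ denotes the $\mathcal{C}^\infty(U)$-submodule of the smooth vector fields (or 1-forms) on $U$ generated by $B$. A rank $r$ distribution on $U$ is a submodule $\mathcal{S}(\{Z_1,\ldots,Z_r\})$ with $Z_1,\ldots,Z_r$ independent vector fields on $U$; its corank is $n-r$; it is involutive if it is closed under the Lie bracket. The kernel $\mathcal{S}(\{\omega\})^{\perp}$ above is a distribution of rank $n-1$. Let $\mathcal{Z}=\mathcal{S}(\{Z_1,\ldots,Z_r\})$ be an involutive distribution of rank $r<n$. A vector field $X$ on $U$ such that $\{Z_1,\ldots,Z_r,X\}$ is independent on $U$ is a $\mathcal{C}^{\infty}$-symmetry of $\mathcal{Z}$ if $\mathcal{S}(\{Z_1,\ldots,Z_r,X\})$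 is involutive, i.e. there are smooth functions $\lambda_i,c_{ik}$ on $U$ with $[X,Z_i]=\lambda_iX+\sum_{k=1}^r c_{ik}Z_k$ for $1\le i\le r$. It is a symmetry of $\mathcal{Z}$ if moreover all $\lambda_i=0$. A non-vanishing smooth function $f$ on $U$ is a symmetrizing factor of the $\mathcal{C}^{\infty}$-symmetry $X$ with respect to $\mathcal{Z}$ if $fX$ is a symmetry of $\mathcal{Z}$. A (non-vanishing) smooth function $\mu$ on $U$ is an integrating factor for $\omega$ if $\mu\omega$ is exact on $U$, i.e. $\mu\omega=dF$ for some $F\in\mathcal{C}^\infty(U)$. For a $\mathcal{C}^\infty$-symmetry $X$ of $\mathcal{S}(\{\omega\})^{\perp}$ the function $X\,\lrcorner\,\omega$ vanishes nowhere on $U$, so $\mu$ above is well defined. *)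

(* Defs.v *)
From HB Require Import structures.
From mathcomp Require Import all_boot all_order all_algebra.
From mathcomp Require Import all_classical all_reals all_analysis.
Set Implicit Arguments.
Unset Strict Implicit.
Unset Printing Implicit Defensive.
Import Order.TTheory GRing.Theory Num.Theory.
Import numFieldNormedType.Exports.
Local Open Scope classical_set_scope.
Local Open Scope ring_scope.

(* Functions, vector fields and forms on U are total functions on R^n whose
   values outside U are irrelevant: for U open, the derivatives at a point of
   U depend only on the values on U.
   - A vector field V is given by its components: V x 0 i is the coefficient of
     the i-th coordinate vector field at x.
   - A 1-form w is given by its components: w x 0 i is the coefficient of dx_i. *)
Definition vfield (R : realType) (n : nat) : Type := 'rV[R]_n -> 'rV[R]_n.
Definition form1 (R : realType) (n : nat) : Type := 'rV[R]_n -> 'rV[R]_n.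

Section Defs.
Variables (R : realType) (n : nat).
Implicit Types (U : set 'rV[R]_n) (V W X : vfield R n) (w : form1 R n).
Implicit Types (D : set (vfield R n)) (f mu F : 'rV[R]_n -> R).

Definition basis_vec (i : 'I_n) : 'rV[R]_n := delta_mx 0 i.

Definition iter_partial (N : normedModType R) (s : seq 'I_n)
    (g : 'rV[R]_n -> N) : 'rV[R]_n -> N :=
  foldr (fun i h x => 'D_(basis_vec i) h x) g s.

(* C^oo on U: all iterated partial derivatives exist and are continuous at
   every point of U. *)
Definition smooth_on (N : normedModType R) U (g : 'rV[R]_n -> N) : Prop :=
  forall (s : seq 'I_n) x, U x ->
    {for x, continuous (iter_partial s g)} /\
    forall i, derivable (iter_partial s g) x (basis_vec i).

Definition star_shaped U : Prop :=
  exists2 x0, U x0 & forall x (t : R), U x -> 0 <= t <= 1 ->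
    U (x0 + t *: (x - x0)).

Definition nonvanishing_on U f : Prop := forall x, U x -> f x != 0.

Definition interior_prod V w : 'rV[R]_n -> R := fun x => \sum_i V x 0 i * w x 0 i.

Definition differential F : form1 R n :=
  fun x => \row_i 'D_(basis_vec i) F x.

(* (d w)_(i, j) = d w (e_i, e_j) *)
Definition ext_deriv w : 'rV[R]_n -> 'M[R]_n := fun x =>
  \matrix_(i, j) ('D_(basis_vec i) (fun y => w y 0 j) x
                  - 'D_(basis_vec j) (fun y => w y 0 i) x).

(* Value on (e_i, e_j, e_k) of the wedge product of the 2-form with
   (skew-symmetric) matrix A and the 1-form with row b. *)
Definition wedge21 (A : 'M[R]_n) (b : 'rV[R]_n) (i j k : 'I_n) : R :=
  A i j * b 0 k + A j k * b 0 i + A k i * b 0 j.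

Definition frobenius_integrable U w : Prop :=
  forall x, U x -> forall i j k, wedge21 (ext_deriv w x) (w x) i j k = 0.

(* [V, W] = (V . grad) W - (W . grad) V *)
Definition lie_bracket V W : vfield R n :=
  fun x => 'D_(V x) W x - 'D_(W x) V x.

Definition independent U r (Z : r.-tuple (vfield R n)) : Prop :=
  forall x, U x -> free [seq V x | V : vfield R n <- Z].

(* The C^oo(U)-submodule S({Z_1, ..., Z_r}) *)
Definition span_on U r (Z : r.-tuple (vfield R n)) : set (vfield R n) :=
  [set V | smooth_on U V /\
    exists c : 'I_r -> 'rV[R]_n -> R, (forall i, smooth_on U (c i)) /\
      forall x, U x -> V x = \sum_i c i x *: tnth Z i x].

Definition involutive_dist D : Prop :=
  forall V W, D V -> D W -> D (lie_bracket V W).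

Definition kernel_distribution U w : set (vfield R n) :=
  [set V | smooth_on U V /\ forall x, U x -> interior_prod V w x = 0].

(* D is the distribution of rank r with independent generators Z. *)
Definition generates U r (Z : r.-tuple (vfield R n)) D : Prop :=
  [/\ forall i, smooth_on U (tnth Z i), independent U Z & D = span_on U Z].

Definition Coo_symmetry_gen U r (Z : r.-tuple (vfield R n)) X : Prop :=
  [/\ smooth_on U X, independent U [tuple of X :: Z]
    & involutive_dist (span_on U [tuple of X :: Z])].

(* All the lambda_i vanish in [X, Z_i] = lambda_i X + \sum_k c_ik Z_k. *)
Definition symmetry_gen U r (Z : r.-tuple (vfield R n)) X : Prop :=
  Coo_symmetry_gen U Z X /\
  exists c : 'I_r -> 'I_r -> 'rV[R]_n -> R,
    (forall i k, smooth_on U (c i k)) /\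
    forall i x, U x ->
      lie_bracket X (tnth Z i) x = \sum_k c i k x *: tnth Z k x.

(* Neither notion depends on the choice of the generators Z of D. *)
Definition Coo_symmetry U D X : Prop :=
  exists r (Z : r.-tuple (vfield R n)), generates U Z D /\ Coo_symmetry_gen U Z X.

Definition is_symmetry U D X : Prop :=
  exists r (Z : r.-tuple (vfield R n)), generates U Z D /\ symmetry_gen U Z X.

Definition scale_field f V : vfield R n := fun x => f x *: V x.

Definition symmetrizing_factor U D X f : Prop :=
  [/\ smooth_on U f, nonvanishing_on U f & is_symmetry U D (scale_field f X)].

Definition exact_on U w : Prop :=
  exists2 F, smooth_on U F & forall x, U x -> w x = differential F x.

Definition integrating_factor U w mu : Prop :=
  [/\ smooth_on U mu, nonvanishing_on U mu & exact_on U (fun x => mu x *: w x)].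

End Defs.

(* Main.v *)
(* Put Y = fX and a = w / (Y . w), so that a(Y) = 1 and a(Z) = 0 for Z in the
   kernel of w. Cartan's formula da(Y, Z) = Y(a(Z)) - Z(a(Y)) - a([Y, Z]) then
   reads da(Y, Z) = - a([Y, Z]), and Y is a symmetry iff da(Y, Z) = 0 for all Z in
   the kernel. Since da /\ a = 0, contraction with Y gives da = a /\ (Y . da), so
   this holds iff da = 0, i.e. iff a is exact, by the Poincare lemma on the
   star-shaped set U. *)
Require Import Defs.
From HB Require Import structures.
From mathcomp Require Import all_boot all_order all_algebra.
From mathcomp Require Import all_classical all_reals all_analysis.
From mathcomp Require Import ring lra.
Import Order.TTheory GRing.Theory Num.Theory.
Import numFieldNormedType.Exports.
Local Open Scope classical_set_scope.
Local Open Scope ring_scope.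

(** * Continuously differentiable functions of several variables *)

(** Smoothness is given only through iterated partial derivatives along the axes. The calculus
    behind Cartan's formula and the Poincare lemma (derivatives in arbitrary directions, symmetry of
    second derivatives, a potential defined by an integral) is therefore built from continuous
    partials by mean value arguments. The other obstacle is that the generators span the kernel as a
    module of smooth fields on U, while the argument needs them pointwise, and their number [r] is
    arbitrary. No dimension is counted: a kernel vector at one point is extended to a smooth kernel
    field on all of U, so it is a combination of the Z_i at that point, and any other vector differs
    from a multiple of Y by a kernel vector. Hence da(Y, .) = 0 need only be checked on Y and the
    Z_i. Conversely, the equality of kernel and span turns a([Y, Z_i]) = 0 into smooth
    coefficients. *)

Lemma derive_line {R : realType} {V W : normedModType R} {f : V -> W}
    {a v : V} {t : R} :
  derivable f (a + t *: v) v ->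
  is_derive t (1 : R) (fun s : R => f (a + s *: v)) ('D_v f (a + t *: v)).
Proof.
have E : (fun h : R => h^-1 *: (((fun s : R => f (a + s *: v)) \o shift t)
      (h *: (1 : R)) - f (a + t *: v))) =
    (fun h => h^-1 *: ((f \o shift (a + t *: v)) (h *: v) - f (a + t *: v))).
  apply/funext => h /=; congr (_ *: (f _ - _)).
  by rewrite scaler1 scalerDl addrCA.
move=> fv; apply: DeriveDef; last by rewrite /derive E.
by rewrite /derivable E.
Qed.

(** The segment is rescaled to [0, 1], so that [k] may be negative or zero without a case split. *)
Lemma mvt_line {R : realType} {V : normedModType R} {f : V -> R}
    {a v : V} (k : R) :
  (forall s, 0 <= s <= 1 -> derivable f (a + (s * k) *: v) v) ->
  exists2 s : R, 0 <= s <= 1 &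
    f (a + k *: v) - f a = k * 'D_v f (a + (s * k) *: v).
Proof.
move=> fv.
have dline (s : R) : 0 <= s <= 1 ->
    is_derive s (1 : R) (fun s => f (a + (s * k) *: v))
      (k * 'D_v f (a + (s * k) *: v)).
  move=> s01; have H := derive_line (fv s s01).
  have Hk : is_derive s (1 : R) (fun s : R => s * k) k.
    have -> : (fun s : R => s * k) = k *: @id R.
      by apply/funext => r; exact: mulrC.
    by apply: is_derive_eq; exact: mulr1.
  have := @is_derive1_comp R (fun s => f (a + s *: v)) (fun s => s * k) s _ _ H Hk.
  by move=> D; apply: is_derive_eq; rewrite mulrC.
have [| |c] := @MVT_segment R (fun s => f (a + (s * k) *: v))
    (fun s => k * 'D_v f (a + (s * k) *: v)) 0 1 ler01.
- by move=> s; rewrite in_itv/= => /andP[s0 s1]; apply: dline; rewrite !ltW.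
- apply: derivable_within_continuous => s; rewrite in_itv/= => s01.
  by have [] := dline s s01.
- rewrite in_itv/= mul1r mul0r scale0r addr0 subr0 mulr1 => c01 ->.
  by exists c.
Qed.

Lemma continuous_sumr {R : realType} {T : topologicalType} {I : finType}
    (F : I -> T -> R) (x : T) :
  (forall i, {for x, continuous (F i)}) ->
  {for x, continuous (fun y => \sum_i F i y)}.
Proof.
move=> Fc; rewrite /prop_for /continuous_at; elim: (index_enum I) => [|i s IHs].
  by under eq_fun do rewrite big_nil; rewrite big_nil; exact: cvg_cst.
by under eq_fun do rewrite big_cons; rewrite big_cons; apply: cvgD => //; exact: Fc.
Qed.

Lemma linear_approx_differentiable {K : realType} {V W : normedModType K}
    (f : V -> W) (L : {linear V -> W}) (x : V) :
  continuous L ->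
  (forall e : K, 0 < e ->
    \forall v \near (0 : V), `|f (v + x) - (f x + L v)| <= e * `|v|) ->
  differentiable f x /\ 'd f x = L :> (V -> W).
Proof.
move=> Lc fL.
have dxf : f \o shift x = cst (f x) + L +o_ (0 : V) id.
  by apply/eqaddoP => _/posnumP[e]; apply: filterS (fL e%:num _).
have df := diff_unique Lc dxf.
by split => //; apply/diff_locallyP; rewrite df.
Qed.

Section PartialDerivatives.
Context {R : realType} {n : nat}.
Implicit Types (x v : 'rV[R]_n) (f g : 'rV[R]_n -> R).

Lemma coord_le_norm v i : `|v 0 i| <= `|v|.
Proof.
rewrite [leRHS]/Num.Def.normr/= mx_normrE.
exact: (le_bigmax _ (fun j : 'I_1 * 'I_n => `|v j.1 j.2|) (0, i)).
Qed.

Lemma ball_rV x (d : R) v : 0 < d -> (forall i, `|v 0 i| < d) -> ball x d (x + v).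
Proof.
move=> d0 vd; rewrite -ball_normE /ball_/= opprD addNKr normrN.
rewrite /Num.Def.normr/= mx_normrE; apply: bigmax_lt => // -[i j] _ /=.
by rewrite (ord1 i).
Qed.

(* The increment along [v] is split into increments along the axes. *)
Lemma increment_le x v f (d e : R) :
  0 <= e -> (forall i, `|v 0 i| < d) ->
  (forall y, ball x d y -> forall i,
     derivable f y (basis_vec R i) /\
     `|'D_(basis_vec R i) f y - 'D_(basis_vec R i) f x| <= e) ->
  `|f (x + v) - f x - \sum_i v 0 i * 'D_(basis_vec R i) f x|
    <= \sum_i `|v 0 i| * e.
Proof.
move=> e0 vd fd.
pose p (k : nat) : 'rV[R]_n := \row_i (if (i < k)%N then v 0 i else 0).
have p0 : p 0%N = 0 by apply/rowP => i; rewrite !mxE ltn0.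
have pn : p n = v by apply/rowP => i; rewrite !mxE ltn_ord.
have pS (k : 'I_n) : p k.+1 = p k + v 0 k *: basis_vec R k.
  apply/rowP => i; rewrite !mxE eqxx /= ltnS leq_eqVlt.
  rewrite -[(nat_of_ord i) == k]/(i == k).
  by have [->|] := eqVneq i k; rewrite ?ltnn ?mulr1 ?add0r ?mulr0 ?addr0.
have -> : f (x + v) - f x = \sum_(k < n) (f (x + p k.+1) - f (x + p k)).
  rewrite -(big_mkord xpredT (fun k => f (x + p k.+1) - f (x + p k))).
  by rewrite telescope_sumr// p0 pn addr0.
rewrite -sumrB; apply: (le_trans (ler_norm_sum _ _ _)); apply: ler_sum => k _.
have d0 : 0 < d by rewrite (le_lt_trans _ (vd k)).
(* The ball is that of the maximum norm: the axis-parallel path stays inside because each of its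
   coordinates is 0, [v 0 i], or a fraction of [v 0 k]. *)
have inball (s : R) : 0 <= s <= 1 ->
    ball x d ((x + p k) + (s * v 0 k) *: basis_vec R k).
  move=> /andP[s0 s1]; rewrite -addrA; apply: ball_rV => // i.
  rewrite !mxE eqxx /=; have [->|ik] := eqVneq i k.
    rewrite ltnn add0r mulr1 normrM (ger0_norm s0).
    by apply: le_lt_trans (vd k); rewrite ler_piMl.
  by rewrite mulr0 addr0; case: ifP => // _; rewrite normr0.
have [|s s01 E] := @mvt_line R _ f (x + p k) (basis_vec R k) (v 0 k).
  by move=> s s01; have [] := fd _ (inball s s01) k.
rewrite pS addrA E -mulrBr normrM ler_wpM2l//.
by have [] := fd _ (inball s s01) k.
Qed.

Lemma derivable_of_partials {U : set 'rV[R]_n} {f} {x} : open U -> U x ->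
  (forall y, U y -> forall i, derivable f y (basis_vec R i)) ->
  (forall i, {for x, continuous ('D_(basis_vec R i) f)}) ->
  differentiable f x /\
  forall v, 'D_v f x = \sum_i v 0 i * 'D_(basis_vec R i) f x.
Proof.
move=> Uo Ux fd fc.
pose L v := \sum_i v 0 i * 'D_(basis_vec R i) f x.
have Llin : linear L.
  move=> a u v; rewrite /L scaler_sumr -big_split /=; apply: eq_bigr => i _.
  by rewrite !mxE mulrDl -mulrA.
pose LL : {linear 'rV[R]_n -> R} := HB.pack L (GRing.isLinear.Build _ _ _ _ L Llin).
have Lc : continuous LL.
  move=> y; apply: continuous_sumr => i.
  apply: (@continuousM _ _ (fun y : 'rV[R]_n => y 0 i) (cst _)).
    exact: coord_continuous.
  exact: cst_continuous.
have [|fdiff df] := linear_approx_differentiable f LL x Lc; last first.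
  by split => // v; rewrite deriveE// df.
move=> _/posnumP[e].
(* The [n] coordinates each contribute at most [e' * |v|]; dividing by [n.+1] instead of [n] also
   covers [n = 0]. *)
pose e' : R := e%:num / n.+1%:R.
have e'0 : 0 < e' by rewrite divr_gt0.
have /nbhs_ballP[d /= d0 dU] : \forall y \near x, U y /\ forall i,
    `|'D_(basis_vec R i) f y - 'D_(basis_vec R i) f x| <= e'.
  apply: filterI; first by apply: open_nbhs_nbhs; split.
  suff fci i : \forall y \near x,
    `|'D_(basis_vec R i) f y - 'D_(basis_vec R i) f x| <= e'.
    by near=> y; near: y; exact: filter_forall.
  have /cvgrPdist_le/(_ _ e'0) := fc i.
  by apply: filterS => y; rewrite distrC.
near=> v.
have vd i : `|v 0 i| < d.
  apply: le_lt_trans (coord_le_norm v i) _.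
  by near: v; exact: (@nbhs0_lt R 'rV[R]_n d d0).
rewrite opprD addrA (addrC v).
apply: (@le_trans _ _ (\sum_(i < n) `|v 0 i| * e')).
  apply: (increment_le x v f d e' (ltW e'0) vd) => y /dU[Uy De] i; split => //.
  exact: fd.
apply: (@le_trans _ _ (\sum_(i < n) `|v| * e')).
  apply: ler_sum => i _; rewrite ler_wpM2r ?(ltW e'0)//.
  exact: coord_le_norm.
rewrite sumr_const card_ord -mulr_natr -mulrA mulrC ler_wpM2r//.
rewrite /e' -mulrA ler_piMr// mulrC ler_pdivrMr// mul1r ler_nat.
exact: leqnSn.
Unshelve. all: by end_near. Qed.

(** * Symmetry of second partial derivatives *)

Lemma is_derive_translate f (c x v : 'rV[R]_n) : derivable f (x + c) v ->
  is_derive x v (fun y => f (y + c)) ('D_v f (x + c)).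
Proof.
have E : (fun h : R => h^-1 *: (((fun y => f (y + c)) \o shift x) (h *: v)
      - f (x + c))) =
    (fun h => h^-1 *: ((f \o shift (x + c)) (h *: v) - f (x + c))).
  by apply/funext => h /=; rewrite addrA.
move=> fv; apply: DeriveDef; last by rewrite /derive E.
by rewrite /derivable E.
Qed.

(** The mean value theorem is applied twice: along the i-th axis to the increment of [f] in
    direction j, then along the j-th axis to the i-th partial derivative. *)
Lemma second_difference {U : set 'rV[R]_n} {f} {x} {d : R} (h : R) (i j : 'I_n) :
  ball x d `<=` U -> 0 < h -> h + h < d ->
  (forall y, U y -> derivable f y (basis_vec R i)) ->
  (forall y, U y -> derivable ('D_(basis_vec R i) f) y (basis_vec R j)) ->
  exists2 y, ball x d y &
    f (x + h *: basis_vec R i + h *: basis_vec R j)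
      - f (x + h *: basis_vec R i)
      - (f (x + h *: basis_vec R j) - f x) =
    h * (h * 'D_(basis_vec R j) ('D_(basis_vec R i) f) y).
Proof.
move=> dU h0 hd fd fdd.
(* When [i = j] both steps add up in the same coordinate, whence the requirement [h + h < d]. *)
have inball (s t : R) : 0 <= s <= 1 -> 0 <= t <= 1 ->
    ball x d (x + (s * h) *: basis_vec R i + (t * h) *: basis_vec R j).
  move=> /andP[s0 s1] /andP[t0 t1]; rewrite -addrA; apply: ball_rV => [|k].
    exact: lt_trans (addr_gt0 h0 h0) hd.
  rewrite !mxE (le_lt_trans _ hd)// (le_trans (ler_normD _ _))//.
  have aux (r : R) (b : bool) : 0 <= r -> r <= 1 -> `|r * h * b%:R| <= h.
    move=> r0 r1; rewrite !normrM (ger0_norm r0) (gtr0_norm h0) normr_nat.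
    by case: b; rewrite ?mulr1 ?mulr0 ?(ltW h0)// ler_piMl// ltW.
  by apply: lerD; exact: aux.
have b0 : 0 <= (0 : R) <= 1 by rewrite lexx ler01.
have b1 : 0 <= (1 : R) <= 1 by rewrite lexx ler01.
have shiftD (s : R) : 0 <= s <= 1 ->
    is_derive (x + (s * h) *: basis_vec R i) (basis_vec R i)
      (fun y => f (y + h *: basis_vec R j) - f y)
      ('D_(basis_vec R i) f
          (x + (s * h) *: basis_vec R i + h *: basis_vec R j)
        - 'D_(basis_vec R i) f (x + (s * h) *: basis_vec R i)).
  move=> s01; apply: is_deriveB; last first.
    apply: derivableP; apply: fd; apply: dU.
    by have := inball _ _ s01 b0; rewrite mul0r scale0r addr0.
  apply: is_derive_translate; apply: fd; apply: dU.
  by have := inball _ _ s01 b1; rewrite mul1r.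
have [s s01|s s01 Es] := @mvt_line R _ (fun y => f (y + h *: basis_vec R j) - f y)
    x (basis_vec R i) h.
  by have [] := shiftD s s01.
have [t t01|t t01 Et] := @mvt_line R _ ('D_(basis_vec R i) f)
    (x + (s * h) *: basis_vec R i) (basis_vec R j) h.
  by apply: fdd; apply: dU; exact: inball.
exists (x + (s * h) *: basis_vec R i + (t * h) *: basis_vec R j).
  exact: inball.
by rewrite Es; have [_ ->] := shiftD s s01; rewrite Et.
Qed.

Lemma two_thirds_lt (d : R) : 0 < d -> d / 3 + d / 3 < d.
Proof. by move=> d0; lra. Qed.

(** Needed because the two orders of differentiation yield different mean value points; continuity
    at [x] absorbs the difference, half of [e] on each side. *)
Lemma continuous_eq_near_points {g1 g2 : 'rV[R]_n -> R} {x} :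
  {for x, continuous g1} -> {for x, continuous g2} ->
  (\forall d \near (0 : R)^'+,
     exists y z, [/\ ball x d y, ball x d z & g1 y = g2 z]) ->
  g1 x = g2 x.
Proof.
move=> c1 c2 g12; apply/eqP; rewrite -subr_eq0 -normr_le0.
apply/ler_addgt0Pr => _/posnumP[e]; rewrite add0r.
have e20 : 0 < e%:num / 2 by rewrite divr_gt0.
have /cvgrPdist_le/(_ _ e20)/nbhs_ballP[d1 /= d10 D1] := c1.
have /cvgrPdist_le/(_ _ e20)/nbhs_ballP[d2 /= d20 D2] := c2.
near (0 : R)^'+ => d.
have [y [z [yd zd E]]] : exists y z, [/\ ball x d y, ball x d z & g1 y = g2 z].
  by near: d.
have Hy : `|g1 x - g1 y| <= e%:num / 2.
  by apply: D1; apply: le_ball yd; near: d; exact: nbhs_right_le.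
have Hz : `|g2 x - g2 z| <= e%:num / 2.
  by apply: D2; apply: le_ball zd; near: d; exact: nbhs_right_le.
rewrite -(subrKA (g1 y)) (splitr e%:num) (le_trans (ler_normD _ _))// lerD//.
by rewrite E distrC.
Unshelve. all: by end_near. Qed.

Lemma derive_commute {U : set 'rV[R]_n} {f} {x} (i j : 'I_n) :
  open U -> U x ->
  (forall y, U y -> forall k, derivable f y (basis_vec R k)) ->
  (forall y, U y -> forall k l,
     derivable ('D_(basis_vec R k) f) y (basis_vec R l)) ->
  (forall k l,
    {for x, continuous ('D_(basis_vec R l) ('D_(basis_vec R k) f))}) ->
  'D_(basis_vec R j) ('D_(basis_vec R i) f) x =
  'D_(basis_vec R i) ('D_(basis_vec R j) f) x.
Proof.
move=> Uo Ux fd fdd fc.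
apply: (@continuous_eq_near_points ('D_(basis_vec R j) ('D_(basis_vec R i) f))
  ('D_(basis_vec R i) ('D_(basis_vec R j) f)) x (fc i j) (fc j i)).
have /nbhs_ballP[d0 /= d00 dU] : \forall y \near x, U y.
  by apply: open_nbhs_nbhs; split.
near=> d.
have d_gt0 : 0 < d by near: d; exact: nbhs_right_gt.
have bU : ball x d `<=` U.
  move=> y dy; apply: dU; apply: le_ball dy; near: d; exact: nbhs_right_le.
have h0 : 0 < d / 3 by rewrite divr_gt0.
have hd := two_thirds_lt d d_gt0.
have [y yd Ey] := second_difference (d / 3) i j bU h0 hd
  (fun z Uz => fd z Uz i) (fun z Uz => fdd z Uz i j).
have [z zd Ez] := second_difference (d / 3) j i bU h0 hd
  (fun z Uz => fd z Uz j) (fun z Uz => fdd z Uz j i).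
exists y, z; split; [exact: yd|exact: zd|].
apply: (mulfI (lt0r_neq0 h0)); apply: (mulfI (lt0r_neq0 h0)).
apply: etrans (esym Ey) (etrans _ Ez).
(* The second difference is symmetric in i and j, so both mean value expressions equal the same
   number. *)
have swap (a b c e : R) : a - b - (c - e) = a - c - (b - e) by ring.
have -> := addrAC x (d / 3 *: basis_vec R i) (d / 3 *: basis_vec R j).
exact: swap.
Unshelve. all: by end_near. Qed.

End PartialDerivatives.

(** * Smooth functions *)

Lemma continuous_rowP {R : realType} {T : topologicalType} {m : nat}
    (h : T -> 'rV[R]_m) (x : T) :
  {for x, continuous h} <-> forall j, {for x, continuous (fun y => h y 0 j)}.
Proof.
split=> [hc j|hc].
  apply: (@continuous_comp _ _ _ h (fun y : 'rV[R]_m => y 0 j)) => //.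
  exact: coord_continuous.
apply/cvgrPdist_le => /= e e0.
suff : \forall y \near x, forall j, `|h x 0 j - h y 0 j| <= e.
  apply: filterS => y hy; rewrite /Num.Def.normr/= mx_normrE.
  by apply: (bigmax_le _ (ltW e0)) => -[i j] _; rewrite !mxE /= (ord1 i).
apply: filter_forall => j.
by have /cvgrPdist_le/(_ _ e0) := hc j.
Qed.

Section Smoothness.
Context {R : realType} {n : nat}.
Implicit Types (U : set 'rV[R]_n) (f g : 'rV[R]_n -> R).

(** Level-by-level form of [smooth_on], for inductions on [k]. Level 0 already asks for partial
    derivatives, so it is stronger than continuity. The recursion peels off the innermost
    derivative, which is the last letter of the word in [iter_partial]; this lets the sum, product
    and inverse rules be applied before the induction hypothesis. *)
Fixpoint Ck (k : nat) {N : normedModType R} U (g : 'rV[R]_n -> N) : Prop :=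
  [/\ forall x, U x -> {for x, continuous g},
      forall x i, U x -> derivable g x (basis_vec R i)
    & if k is k'.+1 then forall i, Ck k' U ('D_(basis_vec R i) g) else True].

Lemma CkP {N : normedModType R} U (g : 'rV[R]_n -> N) :
  smooth_on U g <-> forall k, Ck k U g.
Proof.
split=> [gs k|gC].
- elim: k g gs => [|k IHk] g gs.
    by split=> // x; [case/(gs [::])|move=> i /(gs [::])[]].
  split=> [x|x i|i]; [by case/(gs [::])|by move=> /(gs [::])[]|].
  apply: IHk => s x Ux; have := gs (rcons s i) x Ux.
  by rewrite /iter_partial foldr_rcons.
- move=> s; elim/last_ind: s g gC => [|s i IHs] g gC.
    by move=> x Ux; have [gc gd _] := gC 0%N; split=> [|i]; [exact: gc|exact: gd].
  rewrite /iter_partial foldr_rcons; apply: IHs => k.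
  by have [_ _] := gC k.+1; apply.
Qed.

Lemma CkW {N : normedModType R} k U (g : 'rV[R]_n -> N) : Ck k.+1 U g -> Ck k U g.
Proof.
elim: k g => [|k IHk] g [gc gd gD]; split => // i.
exact: IHk (gD i).
Qed.

Lemma open_near {U} {x} : open U -> U x -> \forall y \near x, U y.
Proof. by move=> Uo Ux; apply: open_nbhs_nbhs; split. Qed.

Lemma near_eq_on {N : normedModType R} {U} {g1 g2 : 'rV[R]_n -> N} {x} :
  open U -> {in U, g1 =1 g2} -> U x -> \forall y \near x, g1 y = g2 y.
Proof.
move=> Uo E Ux; apply: filterS (open_near Uo Ux) => y Uy.
by apply: E; rewrite inE.
Qed.

Lemma continuous_eq_on {N : normedModType R} {U} {g1 g2 : 'rV[R]_n -> N} {x} :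
  open U -> {in U, g1 =1 g2} -> U x ->
  {for x, continuous g1} -> {for x, continuous g2}.
Proof.
move=> Uo E Ux; have NE := near_eq_on Uo E Ux.
rewrite /prop_for /continuous_at -(nbhs_singleton NE) => g1c.
exact: cvg_trans (near_eq_cvg NE) g1c.
Qed.

Lemma derive_eq_on {N : normedModType R} {U} {g1 g2 : 'rV[R]_n -> N} (v : 'rV[R]_n) :
  open U -> {in U, g1 =1 g2} -> {in U, 'D_v g1 =1 'D_v g2}.
Proof.
by move=> Uo E x; rewrite inE => Ux; apply: near_eq_derive; exact: near_eq_on E Ux.
Qed.

(** Differentiation rules give closed forms valid only at points of U; since U is open, agreement on
    U is enough to replace a derivative by its closed form. *)
Lemma Ck_eq {N : normedModType R} k {U} {g1 g2 : 'rV[R]_n -> N} :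
  open U -> {in U, g1 =1 g2} -> Ck k U g1 -> Ck k U g2.
Proof.
move=> Uo; elim: k g1 g2 => [|k IHk] g1 g2 E [gc gd gD].
all: have gc' x : U x -> {for x, continuous g2}
  by move=> Ux; exact: continuous_eq_on Uo E Ux (gc x Ux).
all: have gd' x i : U x -> derivable g2 x (basis_vec R i)
  by move=> Ux; apply: near_eq_derivable (gd x i Ux); exact: near_eq_on E Ux.
all: split => // i.
by apply: IHk (gD i); exact: derive_eq_on.
Qed.

Lemma Ck_cst {N : normedModType R} k U (a : N) : Ck k U (fun=> a).
Proof.
elim: k a => [|k IHk] a; split => //.
- by move=> x _; exact: cst_continuous.
- by move=> x _; exact: cst_continuous.
- move=> i; rewrite (_ : 'D_ _ _ = fun=> 0); first exact: IHk.
  by apply/funext => x; exact: derive_cst.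
Qed.

Lemma CkD k {U} {f g} : open U -> Ck k U f -> Ck k U g -> Ck k U (fun x => f x + g x).
Proof.
move=> Uo; elim: k f g => [|k IHk] f g [fc fd fD] [gc gd gD].
all: have c x : U x -> {for x, continuous (fun x => f x + g x)}
  by move=> Ux; exact: continuousD (fc x Ux) (gc x Ux).
all: have d x i : U x -> derivable (fun x => f x + g x) x (basis_vec R i)
  by move=> Ux; exact: derivableD (fd x i Ux) (gd x i Ux).
all: split => // i.
apply: Ck_eq (IHk _ _ (fD i) (gD i)) => // x; rewrite inE => Ux.
by apply/esym; exact: deriveD (fd x i Ux) (gd x i Ux).
Qed.

Lemma CkM k {U} {f g} : open U -> Ck k U f -> Ck k U g -> Ck k U (fun x => f x * g x).
Proof.
move=> Uo; elim: k f g => [|k IHk] f g Cf Cg.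
all: have [fc fd fD] := Cf; have [gc gd gD] := Cg.
all: have c x : U x -> {for x, continuous (fun x => f x * g x)}
  by move=> Ux; exact: continuousM (fc x Ux) (gc x Ux).
all: have d x i : U x -> derivable (fun x => f x * g x) x (basis_vec R i)
  by move=> Ux; exact: derivableM (fd x i Ux) (gd x i Ux).
all: split => // i.
apply: Ck_eq (CkD k Uo (IHk _ _ (CkW _ _ _ Cf) (gD i))
  (IHk _ _ (CkW _ _ _ Cg) (fD i))) => // x; rewrite inE => Ux.
by apply/esym; exact: deriveM (fd x i Ux) (gd x i Ux).
Qed.

Lemma CkV k {U} {f} : open U -> nonvanishing_on U f -> Ck k U f ->
  Ck k U (fun x => (f x)^-1).
Proof.
move=> Uo f0; elim: k => [|k IHk] Cf.
all: have [fc fd fD] := Cf.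
all: have c x : U x -> {for x, continuous (fun x => (f x)^-1)}
  by move=> Ux; exact: continuousV (f0 x Ux) (fc x Ux).
all: have d x i : U x -> derivable (fun x => (f x)^-1) x (basis_vec R i)
  by move=> Ux; exact: derivableV (f0 x Ux) (fd x i Ux).
all: split => // i.
(* Bootstrap: the derivative of 1/f is -(1/f)^2 times that of f, which has level [k] once 1/f
   does. *)
have Cf' := IHk (CkW _ _ _ Cf).
apply: Ck_eq (CkM k Uo (Ck_cst k U (-1 : R))
  (CkM k Uo (CkM k Uo Cf' Cf') (fD i))) => // x; rewrite inE => Ux.
have -> := deriveV (f0 x Ux) (fd x i Ux).
by rewrite mulN1r /GRing.scale/= mulNr expr2 invfM.
Qed.

Lemma Ck_row k {U} {m} {g : 'rV[R]_n -> 'rV[R]_m} : open U ->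
  Ck k U g <-> forall j, Ck k U (fun x => g x 0 j).
Proof.
move=> Uo.
have gd0 (h : 'rV[R]_n -> 'rV[R]_m) x v :
    derivable h x v <-> forall j, derivable (fun y => h y 0 j) x v.
  apply: iff_trans (derivable_mxP _ _ _) _; split=> [H j|H i j]; first exact: H.
  by rewrite (ord1 i).
elim: k g => [|k IHk] g; split.
- by move=> [gc gd _] j; split=> // [x /gc/continuous_rowP|x i /(gd x i)/gd0]; apply.
- move=> Cg; split=> // [x Ux|x i Ux].
    by apply/continuous_rowP => j; have [+ _ _] := Cg j; apply.
  by apply/gd0 => j; have [_ + _] := Cg j; apply.
- move=> [gc gd gD] j; split=> [x /gc/continuous_rowP|x i /(gd x i)/gd0|i]; [exact|exact|].
  have /IHk/(_ j) := gD i; apply: Ck_eq => // x; rewrite inE => Ux.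
  by rewrite derive_mx ?mxE//; exact: gd.
- move=> Cg; have gd x i : U x -> derivable g x (basis_vec R i).
    by move=> Ux; apply/gd0 => j; have [_ + _] := Cg j; apply.
  split=> // [x Ux|i].
    by apply/continuous_rowP => j; have [+ _ _] := Cg j; apply.
  apply/IHk => j; have [_ _ /(_ i)] := Cg j.
  apply: Ck_eq => // x; rewrite inE => Ux.
  by rewrite derive_mx ?mxE//; exact: gd.
Qed.

Lemma smooth_on_eq {N : normedModType R} {U} {g1 g2 : 'rV[R]_n -> N} :
  open U -> {in U, g1 =1 g2} -> smooth_on U g1 -> smooth_on U g2.
Proof. by move=> Uo E /CkP C1; apply/CkP => k; exact: Ck_eq (C1 k). Qed.

Lemma smooth_on_cst {N : normedModType R} U (a : N) : smooth_on U (fun=> a).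
Proof. by apply/CkP => k; exact: Ck_cst. Qed.

Lemma smooth_onD {U} {f g} : open U -> smooth_on U f -> smooth_on U g ->
  smooth_on U (fun x => f x + g x).
Proof. by move=> Uo /CkP Cf /CkP Cg; apply/CkP => k; exact: CkD. Qed.

Lemma smooth_onM {U} {f g} : open U -> smooth_on U f -> smooth_on U g ->
  smooth_on U (fun x => f x * g x).
Proof. by move=> Uo /CkP Cf /CkP Cg; apply/CkP => k; exact: CkM. Qed.

Lemma smooth_onB {U} {f g} : open U -> smooth_on U f -> smooth_on U g ->
  smooth_on U (fun x => f x - g x).
Proof.
move=> Uo fs gs; apply: (smooth_on_eq Uo) (smooth_onD Uo fs
  (smooth_onM Uo (smooth_on_cst U (-1 : R)) gs)) => x _.
by rewrite mulN1r.
Qed.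

Lemma smooth_onV {U} {f} : open U -> nonvanishing_on U f -> smooth_on U f ->
  smooth_on U (fun x => (f x)^-1).
Proof. by move=> Uo f0 /CkP Cf; apply/CkP => k; exact: CkV. Qed.

Lemma smooth_on_sum {U} {I : finType} {F : I -> 'rV[R]_n -> R} : open U ->
  (forall i, smooth_on U (F i)) -> smooth_on U (fun x => \sum_i F i x).
Proof.
move=> Uo Fs; elim: (index_enum I) => [|i s IHs].
  by apply: (smooth_on_eq Uo) (smooth_on_cst U (0 : R)) => x _; rewrite big_nil.
apply: (smooth_on_eq Uo) (smooth_onD Uo (Fs i) IHs) => x _.
by rewrite big_cons.
Qed.

Lemma smooth_on_rowP {U} {m} {g : 'rV[R]_n -> 'rV[R]_m} : open U ->
  smooth_on U g <-> forall j, smooth_on U (fun x => g x 0 j).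
Proof.
move=> Uo; split=> [/CkP Cg j|Cg]; apply/CkP => k.
  by apply: (Ck_row k Uo).1.
by apply/(Ck_row k Uo) => j; have /CkP := Cg j; apply.
Qed.

Lemma smooth_on_derive {N : normedModType R} {U} {g : 'rV[R]_n -> N} (i : 'I_n) :
  smooth_on U g -> smooth_on U ('D_(basis_vec R i) g).
Proof. by move=> /CkP Cg; apply/CkP => k; have [_ _] := Cg k.+1; apply. Qed.

Lemma smooth_on_continuous {N : normedModType R} {U} {g : 'rV[R]_n -> N} {x} :
  smooth_on U g -> U x -> {for x, continuous g}.
Proof. by move=> /CkP/(_ 0%N)[+ _ _]; apply. Qed.

Lemma smooth_on_derivable {N : normedModType R} {U} {g : 'rV[R]_n -> N} {x} (i : 'I_n) :
  smooth_on U g -> U x -> derivable g x (basis_vec R i).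
Proof. by move=> /CkP/(_ 0%N)[_ + _]; apply. Qed.

Lemma smooth_onS {N : normedModType R} {U} {g : 'rV[R]_n -> N} :
  (forall x, U x -> {for x, continuous g}) ->
  (forall x i, U x -> derivable g x (basis_vec R i)) ->
  (forall i, smooth_on U ('D_(basis_vec R i) g)) -> smooth_on U g.
Proof.
move=> gc gd gD; apply/CkP => -[|k]; split=> // i.
by have /CkP := gD i; apply.
Qed.

Lemma smooth_on_differentiable {U} {f} {x} : open U -> smooth_on U f -> U x ->
  differentiable f x /\
  forall v, 'D_v f x = \sum_i v 0 i * 'D_(basis_vec R i) f x.
Proof.
move=> Uo fs Ux; apply: (derivable_of_partials Uo Ux) => [y Uy i|i].
  exact: smooth_on_derivable fs Uy.
exact: smooth_on_continuous (smooth_on_derive i fs) Ux.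
Qed.

Lemma smooth_on_derive_commute {U} {f} {x} (i j : 'I_n) :
  open U -> smooth_on U f -> U x ->
  'D_(basis_vec R j) ('D_(basis_vec R i) f) x =
  'D_(basis_vec R i) ('D_(basis_vec R j) f) x.
Proof.
move=> Uo fs Ux; apply: (derive_commute i j Uo Ux).
- by move=> y Uy k; exact: smooth_on_derivable fs Uy.
- by move=> y Uy k l; exact: smooth_on_derivable (smooth_on_derive k fs) Uy.
- move=> k l.
  exact: smooth_on_continuous (smooth_on_derive l (smooth_on_derive k fs)) Ux.
Qed.

End Smoothness.

(** * Vector fields and 1-forms *)

(** Cartan's formula at a point with calculus removed: [P i j], [Q i j] and [A i j] stand for the
    i-th partial derivatives of the j-th components of W, V and a. *)
Lemma cartan_sum {R : comRingType} {n : nat} (V W a : 'I_n -> R)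
    (P Q A : 'I_n -> 'I_n -> R) :
  \sum_j (\sum_i V i * P i j - \sum_i W i * Q i j) * a j =
  \sum_i V i * (\sum_j (W j * A i j + a j * P i j))
  - \sum_i W i * (\sum_j (V j * A i j + a j * Q i j))
  - \sum_i \sum_j V i * W j * (A i j - A j i).
Proof.
have -> : \sum_j (\sum_i V i * P i j - \sum_i W i * Q i j) * a j =
    \sum_i \sum_j (V i * P i j * a j - W i * Q i j * a j).
  rewrite exchange_big; apply: eq_bigr => j _.
  by rewrite mulrBl !mulr_suml -sumrB.
(* Exchanging the names of the indices in the second half makes the identity hold term by term. *)
have -> : \sum_i \sum_j V i * W j * (A i j - A j i) =
    \sum_i \sum_j (V i * W j * A i j - V j * W i * A i j).
  rewrite (eq_bigr _ (fun i _ => eq_bigr _ (fun j _ => mulrBr _ _ _))).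
  rewrite (eq_bigr _ (fun i _ => sumrB _ _ _ _)) sumrB.
  rewrite [X in _ - X]exchange_big -sumrB; apply: eq_bigr => i _.
  by rewrite -sumrB.
rewrite -!sumrB; apply: eq_bigr => i _; rewrite !mulr_sumr -!sumrB.
by apply: eq_bigr => j _; ring.
Qed.

Section VectorFields.
Context {R : realType} {n : nat}.
Implicit Types (U : set 'rV[R]_n) (f : 'rV[R]_n -> R).
Implicit Types (V W X : vfield R n) (a w : form1 R n).

Lemma smooth_on_scale {U f V} : open U -> smooth_on U f -> smooth_on U V ->
  smooth_on U (fun x => f x *: V x).
Proof.
move=> Uo fs /(smooth_on_rowP Uo) Vs; apply/(smooth_on_rowP Uo) => j.
by apply: (smooth_on_eq Uo) (smooth_onM Uo fs (Vs j)) => x _; rewrite mxE.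
Qed.

Lemma smooth_on_interior_prod {U V w} : open U -> smooth_on U V -> smooth_on U w ->
  smooth_on U (interior_prod V w).
Proof.
move=> Uo /(smooth_on_rowP Uo) Vs /(smooth_on_rowP Uo) ws.
exact: (smooth_on_sum Uo (fun i => smooth_onM Uo (Vs i) (ws i))).
Qed.

Lemma derive_row {U V} {x} (v : 'rV[R]_n) (j : 'I_n) : open U -> smooth_on U V -> U x ->
  ('D_v V x) 0 j = \sum_i v 0 i * 'D_(basis_vec R i) (fun y => V y 0 j) x.
Proof.
move=> Uo /(smooth_on_rowP Uo) Vs Ux.
rewrite derive_mx ?mxE; last first.
  apply/derivable_mxP => i k; rewrite (ord1 i); apply: diff_derivable.
  by have [] := smooth_on_differentiable Uo (Vs k) Ux.
by have [_ ->] := smooth_on_differentiable Uo (Vs j) Ux.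
Qed.

Lemma smooth_on_lie_bracket {U V W} : open U -> smooth_on U V -> smooth_on U W ->
  smooth_on U (lie_bracket V W).
Proof.
move=> Uo Vs Ws; apply/(smooth_on_rowP Uo) => j.
have sD (V' W' : vfield R n) : smooth_on U V' -> smooth_on U W' -> smooth_on U
    (fun x => \sum_i V' x 0 i * 'D_(basis_vec R i) (fun y => W' y 0 j) x).
  move=> /(smooth_on_rowP Uo) V's /(smooth_on_rowP Uo) W's.
  exact: (smooth_on_sum Uo
    (fun i => smooth_onM Uo (V's i) (smooth_on_derive i (W's j)))).
apply: (smooth_on_eq Uo) (smooth_onB Uo (sD V W Vs Ws) (sD W V Ws Vs)) => x.
by rewrite inE => Ux; rewrite /lie_bracket !mxE !(derive_row _ _ Uo _ Ux).
Qed.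

Lemma derive_interior_prod {U V a} {x} (v : 'rV[R]_n) :
  open U -> smooth_on U V -> smooth_on U a -> U x ->
  'D_v (interior_prod V a) x = \sum_i v 0 i * \sum_j
    (V x 0 j * 'D_(basis_vec R i) (fun y => a y 0 j) x
     + a x 0 j * 'D_(basis_vec R i) (fun y => V y 0 j) x).
Proof.
move=> Uo Vs as_ Ux.
have [_ ->] := smooth_on_differentiable Uo (smooth_on_interior_prod Uo Vs as_) Ux.
apply: eq_bigr => i _; congr (_ * _).
have Vd j : derivable (fun y => V y 0 j) x (basis_vec R i).
  exact: smooth_on_derivable ((smooth_on_rowP Uo).1 Vs j) Ux.
have ad j : derivable (fun y => a y 0 j) x (basis_vec R i).
  exact: smooth_on_derivable ((smooth_on_rowP Uo).1 as_ j) Ux.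
have -> : interior_prod V a =
    \sum_(j < n) ((fun y => V y 0 j) * (fun y => a y 0 j)).
  by apply/funext => y; rewrite /interior_prod fct_sumE.
rewrite derive_sum => [|j]; last exact: derivableM.
by apply: eq_bigr => j _; rewrite deriveM.
Qed.

Lemma cartan_formula {U V W a} {x} :
  open U -> smooth_on U V -> smooth_on U W -> smooth_on U a -> U x ->
  interior_prod (lie_bracket V W) a x =
  'D_(V x) (interior_prod W a) x - 'D_(W x) (interior_prod V a) x
  - \sum_i \sum_j V x 0 i * W x 0 j * ext_deriv a x i j.
Proof.
move=> Uo Vs Ws as_ Ux; rewrite !(derive_interior_prod _ Uo _ as_ Ux)//.
transitivity (\sum_j
    (\sum_i V x 0 i * 'D_(basis_vec R i) (fun y => W y 0 j) x
     - \sum_i W x 0 i * 'D_(basis_vec R i) (fun y => V y 0 j) x) * a x 0 j).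
  by apply: eq_bigr => j _; rewrite /lie_bracket !mxE !(derive_row _ _ Uo _ Ux).
rewrite (cartan_sum _ _ _ _ _
  (fun i j => 'D_(basis_vec R i) (fun y => a y 0 j) x)).
congr (_ - _); apply: eq_bigr => i _; apply: eq_bigr => j _.
by rewrite /ext_deriv mxE.
Qed.

Lemma interior_prodZr V (mu : 'rV[R]_n -> R) w x :
  interior_prod V (fun y => mu y *: w y) x = mu x * interior_prod V w x.
Proof. by rewrite mulr_sumr; apply: eq_bigr => i _; rewrite mxE mulrCA. Qed.

Lemma frobenius_scale {U w} {mu : 'rV[R]_n -> R} :
  open U -> smooth_on U mu -> smooth_on U w -> frobenius_integrable U w ->
  frobenius_integrable U (fun x => mu x *: w x).
Proof.
move=> Uo mus ws wF x Ux i j k; have := wF x Ux i j k.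
have D p q : 'D_(basis_vec R p) (fun y => (mu y *: w y) 0 q) x =
    mu x * 'D_(basis_vec R p) (fun y => w y 0 q) x
    + w x 0 q * 'D_(basis_vec R p) mu x.
  have -> : (fun y => (mu y *: w y) 0 q) = mu * (fun y => w y 0 q).
    by apply/funext => y; rewrite mxE.
  rewrite deriveM//; first exact: smooth_on_derivable Ux.
  exact: smooth_on_derivable ((smooth_on_rowP Uo).1 ws q) Ux.
rewrite /wedge21 /ext_deriv !mxE !D.
(* Six partials of coefficients of [w] and three of [mu] become variables. The identity left to
   [ring] is d(mu w) /\ mu w = mu^2 dw /\ w: the terms in d mu cancel since w /\ w = 0. *)
move: ('D_ _ _ _) ('D_ _ _ _) ('D_ _ _ _) ('D_ _ _ _) ('D_ _ _ _) ('D_ _ _ _)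
  ('D_ _ _ _) ('D_ _ _ _) ('D_ _ _ _) => d1 d2 d3 d4 d5 d6 d7 d8 d9 H.
by rewrite -[RHS](mulr0 (mu x * mu x)) -H; ring.
Qed.

(* Contracting [A /\ a = 0] with [Y] expresses [A] through the contraction of
   [A] with [Y]. *)
Lemma wedge21_contract {A : 'M[R]_n} {a Y : 'rV[R]_n} :
  (forall i j, A i j = - A j i) ->
  (forall i j k, wedge21 A a i j k = 0) -> \sum_k Y 0 k * a 0 k = 1 ->
  (forall j, \sum_k Y 0 k * A k j = 0) -> A = 0.
Proof.
move=> Askew Aa Ya YA; apply/matrixP => i j; rewrite mxE.
have : \sum_k Y 0 k * wedge21 A a i j k = 0.
  by apply: big1 => k _; rewrite Aa mulr0.
have -> : \sum_k Y 0 k * wedge21 A a i j k =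
    A i j * (\sum_k Y 0 k * a 0 k) - a 0 i * (\sum_k Y 0 k * A k j)
    + a 0 j * (\sum_k Y 0 k * A k i).
  rewrite !mulr_sumr -sumrB -big_split; apply: eq_bigr => k _ /=.
  by rewrite /wedge21 (Askew j k); ring.
by rewrite Ya !YA !mulr0 subr0 addr0 mulr1.
Qed.

(** * Pointwise consequences of generating the kernel *)

Section Generators.
Context {U : set 'rV[R]_n} {w : form1 R n} {r : nat} {Z : r.-tuple (vfield R n)}.
Hypotheses (Uo : open U) (ws : smooth_on U w) (wn0 : forall x, U x -> w x != 0).
Hypothesis Zgen : generates U Z (kernel_distribution U w).

Lemma generator_in_kernel i : kernel_distribution U w (tnth Z i).
Proof.
have [Zs _ ->] := Zgen; split; first exact: Zs.
exists (fun k _ => (k == i)%:R); split=> [k|x Ux]; first exact: smooth_on_cst.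
rewrite (bigD1 i)//= eqxx scale1r big1 ?addr0// => k /negPf->.
by rewrite scale0r.
Qed.

(** The span hypothesis concerns smooth fields on U, so [v] is extended to the field |w|^2 v - w(v)
    w. It is annihilated by [w] everywhere and equals |w(x)|^2 v at [x], where the factor is
    nonzero. *)
Lemma kernel_vector_span {x} (v : 'rV[R]_n) :
  U x -> \sum_i v 0 i * w x 0 i = 0 ->
  exists c : 'I_r -> R, v = \sum_i c i *: tnth Z i x.
Proof.
move=> Ux vw.
pose ww := interior_prod w w; pose vw' := interior_prod (fun=> v) w.
have wws : smooth_on U ww := smooth_on_interior_prod Uo ws ws.
have vws : smooth_on U vw' := smooth_on_interior_prod Uo (smooth_on_cst U v) ws.
pose V : vfield R n := fun y => ww y *: v - vw' y *: w y.
have Vs : smooth_on U V.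
  have /(smooth_on_rowP Uo) s1 := smooth_on_scale Uo wws (smooth_on_cst U v).
  have /(smooth_on_rowP Uo) s2 := smooth_on_scale Uo vws ws.
  apply/(smooth_on_rowP Uo) => j.
  by apply: (smooth_on_eq Uo) (smooth_onB Uo (s1 j) (s2 j)) => y _; rewrite !mxE.
have VD : kernel_distribution U w V.
  split=> // y _; rewrite /interior_prod.
  rewrite (eq_bigr (fun i => ww y * (v 0 i * w y 0 i) - vw' y * (w y 0 i * w y 0 i))).
    by rewrite sumrB -!mulr_sumr mulrC subrr.
  by move=> i _; rewrite !mxE; ring.
have ww0 : ww x != 0.
  apply: contra (wn0 x Ux); rewrite psumr_eq0 => [/allP w0|i _]; last first.
    by rewrite -expr2 sqr_ge0.
  apply/eqP/rowP => i; rewrite mxE; apply/eqP.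
  by have := w0 i (mem_index_enum i); rewrite /= mulf_eq0 orbb.
have [_ _ KZ] := Zgen; move: VD; rewrite KZ => -[_ [c [_ /(_ x Ux) Vc]]].
exists (fun i => (ww x)^-1 * c i x).
have -> : v = (ww x)^-1 *: V x.
  have vw'0 : vw' x = 0 by [].
  by rewrite /V vw'0 scale0r subr0 scalerA mulVf// scale1r.
by rewrite Vc scaler_sumr; apply: eq_bigr => i _; rewrite scalerA.
Qed.

(** If [w] annihilated X at [x], then X(x) would be a combination of the Z_i(x), against
    independence. *)
Lemma interior_prod_neq0 {X} {x} : independent U [tuple of X :: Z] -> U x ->
  interior_prod X w x != 0.
Proof.
move=> /(_ x) + Ux => /(_ Ux) /=; rewrite free_cons => /andP[+ _].
apply: contra => /eqP Xw; have [c ->] := kernel_vector_span (X x) Ux Xw.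
apply: memv_suml => i _; apply: memvZ; apply: memv_span.
by apply: map_f; exact: mem_tnth.
Qed.

Lemma transversal_span {X} {x} (v : 'rV[R]_n) : independent U [tuple of X :: Z] -> U x ->
  exists (b : R) (c : 'I_r -> R), v = b *: X x + \sum_i c i *: tnth Z i x.
Proof.
move=> XZ Ux; have Xw := interior_prod_neq0 XZ Ux.
(* The only coefficient for which [v - b *: X x] lies in the kernel of [w x]. *)
pose b := (\sum_i v 0 i * w x 0 i) / interior_prod X w x.
have [|c E] := kernel_vector_span (v - b *: X x) Ux.
  rewrite (eq_bigr (fun i => v 0 i * w x 0 i - b * (X x 0 i * w x 0 i))).
    by rewrite sumrB -mulr_sumr divfK ?subrr.
  by move=> i _; rewrite !mxE; ring.
by exists b, c; rewrite -E addrC subrK.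
Qed.

End Generators.
End VectorFields.

(** * The Poincare lemma *)

(** Its hypothesis has the shape of the limit delivered by differentiation under the integral sign
    at parameter 0. *)
Lemma is_derive_line0 {R : realType} {V W : normedModType R} {f : V -> W}
    {x v : V} {l : W} :
  h^-1 *: (f (x + (h + 0) *: v) - f (x + 0 *: v)) @[h --> (0 : R)^'] --> l ->
  is_derive x v f l.
Proof.
have -> : (fun h : R => h^-1 *: (f (x + (h + 0) *: v) - f (x + 0 *: v))) =
    (fun h => h^-1 *: ((f \o shift x) (h *: v) - f x)).
  by apply/funext => h /=; rewrite addr0 scale0r addr0 (addrC x).
move=> fl; apply: DeriveDef; first by apply/cvg_ex; exists l; exact: fl.
by apply: cvg_lim => //; exact: fl.
Qed.

Section Poincare.
Context {R : realType} {n : nat} (U : set 'rV[R]_n) (a : form1 R n) (x0 : 'rV[R]_n).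
Hypotheses (Uo : open U) (as_ : smooth_on U a).
Hypothesis Ustar : forall {x} {t : R}, U x -> 0 <= t <= 1 -> U (x0 + t *: (x - x0)).

(** [P y] runs along the segment from [x0] to [y], the integral of [g y] over [0, 1] is the line
    integral of [a] along it, and [dg j] is the partial derivative of [g] in the j-th coordinate of
    [y]. *)
Let P (y : 'rV[R]_n) (t : R) : 'rV[R]_n := x0 + t *: (y - x0).
Let g (y : 'rV[R]_n) (t : R) : R := \sum_i (y - x0) 0 i * a (P y t) 0 i.
Let dg (j : 'I_n) (y : 'rV[R]_n) (t : R) : R :=
  \sum_i ((y - x0) 0 i * (t * 'D_(basis_vec R j) (fun z => a z 0 i) (P y t))
          + a (P y t) 0 i * (i == j)%:R).

Let coefs i : smooth_on U (fun z => a z 0 i) := (smooth_on_rowP Uo).1 as_ i.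

Lemma is_derive_coef_line {z v : 'rV[R]_n} {t : R} (i : 'I_n) : U (z + t *: v) ->
  is_derive t (1 : R) (fun s : R => a (z + s *: v) 0 i)
    (\sum_k v 0 k * 'D_(basis_vec R k) (fun y => a y 0 i) (z + t *: v)).
Proof.
move=> Uz; have [fd fD] := smooth_on_differentiable Uo (coefs i) Uz.
by rewrite -fD; exact: (derive_line (diff_derivable fd)).
Qed.

Lemma is_derive_integrand (x : 'rV[R]_n) (j : 'I_n) (s t : R) :
  U (P (x + s *: basis_vec R j) t) ->
  is_derive s (1 : R) (fun s => g (x + s *: basis_vec R j) t)
    (dg j (x + s *: basis_vec R j) t).
Proof.
(* Moving the endpoint by u moves the point at time [t] by t u only; this is the factor [t] in
   [dg]. *)
have PE u : P (x + u *: basis_vec R j) t = P x t + u *: (t *: basis_vec R j).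
  by rewrite /P addrAC scalerDr addrA !scalerA (mulrC u).
move=> UP; rewrite /g /dg.
have D i : is_derive s (1 : R)
    (fun s => (x + s *: basis_vec R j - x0) 0 i * a (P (x + s *: basis_vec R j) t) 0 i)
    ((x + s *: basis_vec R j - x0) 0 i *
       (t * 'D_(basis_vec R j) (fun z => a z 0 i) (P (x + s *: basis_vec R j) t))
     + a (P (x + s *: basis_vec R j) t) 0 i * (i == j)%:R).
  have D1 : is_derive s (1 : R) (fun s => (x + s *: basis_vec R j - x0) 0 i) (i == j)%:R.
    have -> : (fun s : R => (x + s *: basis_vec R j - x0) 0 i) =
        cst ((x - x0) 0 i) + (i == j)%:R *: @id R.
      by apply/funext => u; rewrite !mxE /= addrAC [u * _]mulrC.
    by apply: is_derive_eq; rewrite add0r; exact: mulr1.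
  have D2 : is_derive s (1 : R) (fun s => a (P (x + s *: basis_vec R j) t) 0 i)
      (t * 'D_(basis_vec R j) (fun z => a z 0 i) (P (x + s *: basis_vec R j) t)).
    rewrite (funext (fun u => congr1 (fun z => a z 0 i) (PE u))) PE.
    rewrite PE in UP; have := is_derive_coef_line i UP.
    rewrite (bigD1 j)//= big1 ?addr0 => [|k kj].
      by rewrite !mxE !eqxx mulr1.
    by rewrite !mxE eqxx (negPf kj) mulr0 mul0r.
  exact: (is_deriveM D1 D2).
have -> : (fun s => \sum_i (x + s *: basis_vec R j - x0) 0 i *
      a (P (x + s *: basis_vec R j) t) 0 i) =
    \sum_(i < n) (fun s => (x + s *: basis_vec R j - x0) 0 i *
      a (P (x + s *: basis_vec R j) t) 0 i).
  by apply/funext => u; rewrite fct_sumE.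
exact: is_derive_sum.
Qed.

Section Continuity.
Context {T : topologicalType} {c : T -> 'rV[R]_n} {tau : T -> R} {p : T}.
Hypotheses (cc : {for p, continuous c}) (tauc : {for p, continuous tau}).
Hypothesis UP : U (P (c p) (tau p)).

(** The endpoint and the time depend on a point of an arbitrary space: the real line gives
    continuity in t at a fixed endpoint, the plane gives joint continuity of [dg]. *)
Lemma continuous_segment_comp {f : 'rV[R]_n -> R} :
  smooth_on U f -> {for p, continuous (fun q => f (P (c q) (tau q)))}.
Proof.
move=> fs; apply: (@continuous_comp _ _ _ (fun q => P (c q) (tau q)) f); last first.
  exact: smooth_on_continuous fs UP.
apply: cvgD; first exact: cvg_cst.
by apply: cvgZ => //; apply: cvgB => //; exact: cvg_cst.
Qed.

Let coord_c i : {for p, continuous (fun q => (c q - x0) 0 i)}.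
Proof.
rewrite (_ : (fun q => _) = (fun q => c q 0 i - x0 0 i)); last first.
  by apply/funext => q; rewrite !mxE.
apply: cvgB; last exact: cvg_cst.
exact: (@continuous_rowP R T n c p).1.
Qed.

Lemma continuous_integrand : {for p, continuous (fun q => g (c q) (tau q))}.
Proof.
apply: continuous_sumr => i.
exact: continuousM (coord_c i) (continuous_segment_comp (coefs i)).
Qed.

Lemma continuous_dintegrand j : {for p, continuous (fun q => dg j (c q) (tau q))}.
Proof.
apply: continuous_sumr => i; apply: continuousD.
  apply: (continuousM (coord_c i)); apply: (continuousM tauc).
  exact: (continuous_segment_comp (smooth_on_derive j (coefs i))).
apply: (continuousM (continuous_segment_comp (coefs i))).
exact: cst_continuous.
Qed.

End Continuity.
Hypothesis aclosed : forall {x}, U x -> ext_deriv a x = 0.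

Let F (y : 'rV[R]_n) : R := \int[lebesgue_measure]_(t in `[0, 1]) g y t.

(** Closedness exchanges the indices i and j in the partial derivatives of [a], which turns [dg j x]
    into an exact t-derivative. *)
Lemma is_derive_radial (x : 'rV[R]_n) (j : 'I_n) (t : R) : U x -> 0 <= t <= 1 ->
  is_derive t (1 : R) (fun t : R => t * a (P x t) 0 j) (dg j x t).
Proof.
move=> Ux t01; have UP : U (P x t) := Ustar Ux t01.
have D := is_derive_coef_line j UP.
have D' : is_derive t (1 : R) (fun t : R => t * a (P x t) 0 j) _ :=
  is_deriveM (is_derive_id t 1) D.
apply: is_derive_eq; rewrite /dg big_split /=.
congr (_ + _).
  rewrite /GRing.scale/= mulr_sumr; apply: eq_bigr => i _; rewrite mulrCA.
  congr (_ * (_ * _)); apply/eqP; rewrite -subr_eq0; apply/eqP.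
  by have /matrixP/(_ i j) := aclosed UP; rewrite !mxE.
rewrite (bigD1 j)//= eqxx big1 ?addr0 => [|i /negPf->]; last by rewrite mulr0.
by rewrite mulr1 [LHS]mulr1.
Qed.

Lemma integral_dintegrand (x : 'rV[R]_n) (j : 'I_n) : U x ->
  \int[lebesgue_measure]_(t in `[0, 1]) dg j x t = a x 0 j.
Proof.
move=> Ux.
have D (t : R) : 0 <= t <= 1 -> is_derive t (1 : R) (fun t : R => t * a (P x t) 0 j) (dg j x t).
  exact: is_derive_radial.
have c (t : R) : 0 <= t <= 1 -> {for t, continuous (fun t : R => t * a (P x t) 0 j)}.
  move=> /D[+ _] => /derivable1_diffP; exact: differentiable_continuous.
rewrite /Rintegral.
(* The primitive vanishes at 0 by its factor t, and at 1 the segment has reached [x]. *)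
rewrite (@continuous_FTC2 R (dg j x) (fun t : R => t * a (P x t) 0 j) 0 1 ltr01).
- rewrite /= mul1r mul0r subr0 /P scale1r addrC subrK//.
- apply: continuous_in_subspaceT => t; rewrite inE /= in_itv /= => t01.
  apply: (@continuous_dintegrand R (fun=> x) id t) => //.
  + exact: cst_continuous.
  + exact: Ustar.
- split.
  + by move=> t; rewrite in_itv/= => /andP[t0 t1]; have [] := D t; rewrite ?ltW.
  + by apply: cvg_at_right_filter; apply: c; rewrite lexx ler01.
  + by apply: cvg_at_left_filter; apply: c; rewrite lexx ler01.
- move=> t; rewrite in_itv/= => /andP[t0 t1].
  have t01 : 0 <= t <= 1 by rewrite !ltW.
  by rewrite derive1E; have [_ ->] := D t t01.
Qed.

Lemma is_derive_potential (x : 'rV[R]_n) (j : 'I_n) : U x ->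
  is_derive x (basis_vec R j) F (a x 0 j).
Proof.
move=> Ux; rewrite -(integral_dintegrand _ j Ux).
have /nbhs_ballP[d /= d0 dU] := open_near Uo Ux.
(* Half the radius, so that even the closed segment of parameters stays in U; its compactness gives
   the bound [M] below. *)
pose h : R := d / 2; have h0 : 0 < h by rewrite divr_gt0.
have Ux' (s : R) : - h <= s <= h -> U (x + s *: basis_vec R j).
  rewrite -ler_norml => sh; apply: dU; apply: ball_rV => // i.
  rewrite !mxE eqxx /= (@le_lt_trans _ _ h)//; last by rewrite gtr_pMr// invf_lt1 ?ltr1n.
  by rewrite normrM normr_nat; case: (i == j); rewrite ?mulr1 ?mulr0// ltW.
have Uitv s : `]- h, h[%classic s -> - h <= s <= h.
  by rewrite /= in_itv/= => /andP[/ltW-> /ltW->].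
have mB : measurable (`[0, 1]%classic : set R) by [].
have cg y : U y -> lebesgue_measure.-integrable `[0, 1] (EFin \o g y).
  move=> Uy; apply: continuous_compact_integrable; first exact: segment_compact.
  apply: continuous_in_subspaceT => t; rewrite inE /= in_itv /= => t01.
  apply: (@continuous_integrand R (fun=> y) id t) => //.
  + exact: cst_continuous.
  + exact: Ustar.
pose K : set (R * R) := `[- h, h] `*` `[0, 1].
have Kc : compact K by apply: compact_setX; exact: segment_compact.
have K0 : K !=set0.
  by exists (0, 0); split; rewrite /= in_itv/= ?lexx ?ler01// oppr_le0 ltW.
(* The constant dominating function: a maximum of the continuous |dg| on the compact rectangle
   [K]. *)
have [M M0 HM] : exists2 M, 0 <= M & forall s t, - h <= s <= h -> 0 <= t <= 1 ->
    `|dg j (x + s *: basis_vec R j) t| <= M.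
  have Kcont : {within K, continuous
      (fun q : R * R => `|dg j (x + q.1 *: basis_vec R j) q.2|)}.
    apply: continuous_in_subspaceT => -[s t]; rewrite inE => -[/=].
    rewrite !in_itv/= => sh t01.
    apply: (@continuous_comp _ _ _
      (fun q : R * R => dg j (x + q.1 *: basis_vec R j) q.2) Num.norm); last first.
      exact: norm_continuous.
    apply: (@continuous_dintegrand _ (fun q : R * R => x + q.1 *: basis_vec R j)
      snd (s, t)); last first.
    - by apply: Ustar => //; exact: Ux'.
    - exact: cvg_snd.
    - by apply: cvgD; [exact: cvg_cst|apply: cvgZr_tmp; exact: cvg_fst].
  have [p _ pmax] := compact_EVT_max K0 Kc Kcont.
  exists `|dg j (x + p.1 *: basis_vec R j) p.2| => // s t sh t01.
  by apply: (pmax (s, t)); rewrite inE; split; rewrite /= in_itv/=.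
have inth : `]- h, h[%classic (0 : R) by rewrite /= in_itv/= oppr_lt0 h0.
have derf (s t : R) : `]- h, h[%classic s -> `[0, 1]%classic t ->
    is_derive s (1 : R) (fun s => g (x + s *: basis_vec R j) t)
      (dg j (x + s *: basis_vec R j) t).
  move=> /Uitv sh; rewrite /= in_itv/= => t01; apply: is_derive_integrand.
  by apply: Ustar => //; exact: Ux'.
apply: is_derive_line0.
have := @cvg_differentiation_under_integral R _ _ lebesgue_measure
  (fun s t => g (x + s *: basis_vec R j) t) `[0, 1]%classic mB 0 (- h) h inth
  _ _ (fun=> M) _ _ _.
have -> : \int[lebesgue_measure]_(y in `[0, 1])
    partial1of2 (fun s t => g (x + s *: basis_vec R j) t) 0 y =
    \int[lebesgue_measure]_(t in `[0, 1]) dg j x t.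
  apply: eq_Rintegral => t; rewrite inE => t01; rewrite partial1of2E.
  by have [_ ->] := derf 0 t inth t01; rewrite scale0r addr0.
apply.
- by move=> s /Uitv sh; apply: cg; exact: Ux'.
- by move=> s t sh t01; have [] := derf s t sh t01.
- by move=> _; exact: M0.
- apply: continuous_compact_integrable; first exact: segment_compact.
  by apply: continuous_in_subspaceT => t _; exact: cst_continuous.
- move=> s t sh t01; rewrite partial1of2E; have [_ ->] := derf s t sh t01.
  by apply: HM; [exact: Uitv|move: t01; rewrite /= in_itv].
Qed.

End Poincare.

Lemma poincare {R : realType} {n : nat} {U : set 'rV[R]_n} {a : form1 R n} :
  open U -> star_shaped U -> smooth_on U a ->
  (forall x, U x -> ext_deriv a x = 0) -> exact_on U a.
Proof.
move=> Uo [x0 _ Ustar] as_ aclosed.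
pose F (y : 'rV[R]_n) : R := \int[lebesgue_measure]_(t in `[0, 1])
  (\sum_i (y - x0) 0 i * a (x0 + t *: (y - x0)) 0 i).
have FD x j : U x -> is_derive x (basis_vec R j) F (a x 0 j).
  exact: is_derive_potential.
have FE j : {in U, (fun x => a x 0 j) =1 'D_(basis_vec R j) F}.
  by move=> x; rewrite inE => Ux; have [_ ->] := FD x j Ux.
have Fd x i : U x -> derivable F x (basis_vec R i) by move=> /(FD x i)[].
have as_j := (smooth_on_rowP Uo).1 as_.
have Fs j : smooth_on U ('D_(basis_vec R j) F) := smooth_on_eq Uo (FE j) (as_j j).
exists F.
  (* The partials of [F] are the coefficients of [a] on U, hence smooth; only continuity of [F]
     itself remains, and it follows from continuity of these partials. *)
  apply: (smooth_onS _ Fd Fs) => x Ux; apply: differentiable_continuous.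
  have [] // := derivable_of_partials Uo Ux (fun y Uy i => Fd y i Uy).
  by move=> i; exact: smooth_on_continuous (Fs i) Ux.
move=> x Ux; apply/rowP => j; rewrite mxE.
by apply: FE; rewrite inE.
Qed.

(** * Symmetries and integrating factors *)

Section Symmetry.
Context {R : realType} {n : nat} {U : set 'rV[R]_n} {w : form1 R n}.
Implicit Types (V X Y : vfield R n) (a : form1 R n) (f mu : 'rV[R]_n -> R).

Lemma span_on_rescale {r} {Z Z' : r.-tuple (vfield R n)}
    {k : 'I_r -> 'rV[R]_n -> R} : open U -> (forall i, smooth_on U (k i)) ->
  (forall i x, U x -> tnth Z i x = k i x *: tnth Z' i x) ->
  span_on U Z `<=` span_on U Z'.
Proof.
move=> Uo ks Zk V [Vs [c [cs Vc]]]; split => //.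
exists (fun i x => c i x * k i x); split=> [i|x Ux]; first exact: (smooth_onM Uo (cs i) (ks i)).
by rewrite Vc//; apply: eq_bigr => i _; rewrite Zk// scalerA.
Qed.

Lemma span_on_scale_head {r} {Z : r.-tuple (vfield R n)} {X f} : open U ->
  smooth_on U f -> nonvanishing_on U f ->
  span_on U [tuple of scale_field f X :: Z] = span_on U [tuple of X :: Z].
Proof.
move=> Uo fs f0.
(* Only the head is rescaled, by [f] for one inclusion and by its inverse for the other. *)
have ks (g : 'rV[R]_n -> R) (i : 'I_r.+1) : smooth_on U g ->
    smooth_on U (if i == ord0 then g else fun=> 1).
  by move=> gs; case: (i == ord0); [exact: gs|exact: smooth_on_cst].
apply/seteqP; split.
  apply: (span_on_rescale Uo (fun i => ks f i fs)) => i x Ux.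
  by case: (unliftP ord0 i) => [j|] ->; rewrite ?tnthS ?tnth0//= scale1r.
apply: (span_on_rescale Uo (fun i => ks _ i (smooth_onV Uo f0 fs))) => i x Ux.
case: (unliftP ord0 i) => [j|] ->; rewrite ?tnthS ?tnth0//= ?scale1r//.
by rewrite /scale_field scalerA mulVf ?scale1r//; exact: f0.
Qed.

Lemma derive_const_on {g : 'rV[R]_n -> R} (b : R) {x} (v : 'rV[R]_n) : open U ->
  (forall y, U y -> g y = b) -> U x -> 'D_v g x = 0.
Proof.
move=> Uo gb Ux.
have E : {in U, g =1 cst b} by move=> y; rewrite inE => /gb.
by rewrite (derive_eq_on v Uo E) ?inE// derive_cst.
Qed.

(** Constancy of a(Y) and a(V) on U removes both derivative terms of Cartan's formula. The pair (1,
    1) serves for Y with itself, (1, 0) for Y with a generator. *)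
Lemma interior_prod_lie_bracket {V Y a} (b d : R) {x} : open U -> smooth_on U Y ->
  smooth_on U V -> smooth_on U a -> (forall y, U y -> interior_prod Y a y = b) ->
  (forall y, U y -> interior_prod V a y = d) -> U x ->
  interior_prod (lie_bracket Y V) a x =
  - \sum_i \sum_j Y x 0 i * V x 0 j * ext_deriv a x i j.
Proof.
move=> Uo Ys Vs as_ Yb Vd Ux; rewrite (cartan_formula Uo Ys Vs as_ Ux).
by rewrite (derive_const_on d _ Uo Vd Ux) (derive_const_on b _ Uo Yb Ux) subrr sub0r.
Qed.

Lemma ext_deriv_skew a x i j : ext_deriv a x i j = - ext_deriv a x j i.
Proof. by rewrite !mxE opprB. Qed.

Lemma symmetry_closed {r} {Z : r.-tuple (vfield R n)} {Y} :
  open U -> smooth_on U w -> (forall x, U x -> w x != 0) ->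
  frobenius_integrable U w -> generates U Z (kernel_distribution U w) ->
  symmetry_gen U Z Y -> forall x, U x ->
  ext_deriv (fun y => (interior_prod Y w y)^-1 *: w y) x = 0.
Proof.
move=> Uo ws wn0 wF Zgen [[Ys YZ _] [c [_ YZc]]] x Ux.
have h0 : nonvanishing_on U (interior_prod Y w).
  by move=> y Uy; exact: (interior_prod_neq0 Uo ws wn0 Zgen YZ Uy).
have mus := smooth_onV Uo h0 (smooth_on_interior_prod Uo Ys ws).
pose a : form1 R n := fun y => (interior_prod Y w y)^-1 *: w y.
have as_ : smooth_on U a := smooth_on_scale Uo mus ws.
have Ya y : U y -> interior_prod Y a y = 1.
  by move=> Uy; rewrite /a interior_prodZr mulVf//; exact: h0.
have [Zs _ _] := Zgen.
have Zw i y : U y -> interior_prod (tnth Z i) w y = 0.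
  by move=> Uy; have [_ ->] := generator_in_kernel Zgen i.
have Za i y : U y -> interior_prod (tnth Z i) a y = 0.
  by move=> Uy; rewrite /a interior_prodZr Zw// mulr0.
pose A := ext_deriv a x.
have YY : \sum_i \sum_j Y x 0 i * Y x 0 j * A i j = 0.
  apply: oppr_inj; rewrite oppr0.
  rewrite -(interior_prod_lie_bracket 1 1 Uo Ys Ys as_ Ya Ya Ux).
  by apply: big1 => i _; rewrite /lie_bracket subrr mxE mul0r.
(* [Y, Z_i] has no component along Y, so [a] annihilates it. *)
have YZi i : \sum_k \sum_j Y x 0 k * tnth Z i x 0 j * A k j = 0.
  apply: oppr_inj; rewrite oppr0.
  rewrite -(interior_prod_lie_bracket 1 0 Uo Ys (Zs i) as_ Ya (Za i) Ux).
  rewrite /a interior_prodZr [X in _ * X](_ : _ = 0) ?mulr0//.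
  rewrite /interior_prod YZc//.
  under eq_bigr => k _ do rewrite summxE mulr_suml.
  rewrite exchange_big big1// => l _.
  under eq_bigr => k _ do rewrite mxE -mulrA.
  by rewrite -mulr_sumr [X in _ * X](Zw l x Ux) mulr0.
apply: (wedge21_contract (a := a x) (Y := Y x)).
- exact: ext_deriv_skew.
- exact: (frobenius_scale Uo mus ws wF).
- exact: Ya.
(* [B] is the linear form da(Y, .). It vanishes on Y and on the Z_i, and every basis vector is a
   combination of these at [x]. *)
- move=> j; pose B (v : 'rV[R]_n) := \sum_k \sum_l Y x 0 k * v 0 l * A k l.
  have BD u v : B (u + v) = B u + B v.
    rewrite /B -big_split; apply: eq_bigr => k _; rewrite -big_split.
    by apply: eq_bigr => l _ /=; rewrite mxE; ring.
  have BZ b v : B (b *: v) = b * B v.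
    rewrite /B mulr_sumr; apply: eq_bigr => k _; rewrite mulr_sumr.
    by apply: eq_bigr => l _ /=; rewrite mxE; ring.
  have B0 : B 0 = 0 by rewrite -(scale0r 0) BZ mul0r.
  have -> : \sum_k Y x 0 k * A k j = B (basis_vec R j).
    apply: eq_bigr => k _; rewrite (bigD1 j)//= big1 => [|l lj].
      by rewrite !mxE !eqxx mulr1 addr0.
    by rewrite [basis_vec _ _ _ _]mxE eqxx (negPf lj) mulr0 mul0r.
  have [b [e ->]] := transversal_span Uo ws wn0 Zgen (basis_vec R j) YZ Ux.
  rewrite BD BZ [B (Y x)]YY mulr0 add0r.
  elim/big_ind: _ => [|u v Bu Bv|i _]; first exact: B0.
    by rewrite BD Bu Bv addr0.
  by rewrite BZ [B _]YZi mulr0.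
Qed.

Lemma exact_closed {a} : open U -> exact_on U a ->
  forall x, U x -> ext_deriv a x = 0.
Proof.
move=> Uo [F Fs aF] x Ux; apply/matrixP => i j; rewrite !mxE.
have E k : {in U, (fun y => a y 0 k) =1 'D_(basis_vec R k) F}.
  by move=> y; rewrite inE => /aF ->; rewrite mxE.
rewrite !(derive_eq_on _ Uo (E _)) ?inE//.
by rewrite (smooth_on_derive_commute i j Uo Fs Ux) subrr.
Qed.

Lemma integrating_factor_symmetry {r} {Z : r.-tuple (vfield R n)} {Y mu} :
  open U -> smooth_on U w -> generates U Z (kernel_distribution U w) ->
  Coo_symmetry_gen U Z Y -> integrating_factor U w mu ->
  (forall x, U x -> mu x * interior_prod Y w x = 1) -> symmetry_gen U Z Y.
Proof.
move=> Uo ws Zgen YZ [mus mu0 muw] muY; split; first exact: YZ.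
have [Ys _ _] := YZ; have [Zs _ KZ] := Zgen.
pose a : form1 R n := fun x => mu x *: w x.
have as_ : smooth_on U a := smooth_on_scale Uo mus ws.
have Ya x : U x -> interior_prod Y a x = 1.
  by move=> Ux; rewrite /a interior_prodZr muY.
have Za i x : U x -> interior_prod (tnth Z i) a x = 0.
  move=> Ux; have [_ Zw] := generator_in_kernel Zgen i.
  by rewrite /a interior_prodZr Zw// mulr0.
have KYZ i : kernel_distribution U w (lie_bracket Y (tnth Z i)).
  split=> [|x Ux]; first exact: (smooth_on_lie_bracket Uo Ys (Zs i)).
  (* Multiplying by [mu] replaces [w] by the closed form [a], for which the bracket formula has
     right-hand side 0. *)
  apply: (mulfI (mu0 x Ux)); rewrite mulr0 -interior_prodZr.
  rewrite (interior_prod_lie_bracket 1 0 Uo Ys (Zs i) as_ Ya (Za i) Ux).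
  rewrite (exact_closed Uo muw _ Ux) big1 ?oppr0// => k _.
  by apply: big1 => l _; rewrite mxE mulr0.
(* Read in the span of [Z], kernel membership supplies smooth coefficients without any component
   along Y: all lambda_i vanish. *)
have /choice[c cE] i : exists c : 'I_r -> 'rV[R]_n -> R,
    (forall k, smooth_on U (c k)) /\
    forall x, U x -> lie_bracket Y (tnth Z i) x = \sum_k c k x *: tnth Z k x.
  by have := KYZ i; rewrite KZ => -[_].
exists c; split=> [i k|i x]; first by have [+ _] := cE i; apply.
by have [_] := cE i; apply.
Qed.

Lemma Coo_symmetry_gen_scale {r} {Z : r.-tuple (vfield R n)} {X f} :
  open U -> smooth_on U f -> nonvanishing_on U f ->
  Coo_symmetry_gen U Z X -> Coo_symmetry_gen U Z (scale_field f X).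
Proof.
move=> Uo fs f0 [Xs XZ XZinv]; split.
- exact: (smooth_on_scale Uo fs Xs).
- move=> x Ux; have := XZ x Ux; rewrite /= !free_cons => /andP[XnZ ->].
  rewrite andbT; apply: contra XnZ => fXZ.
  by rewrite -(scale1r (X x)) -(mulVf (f0 x Ux)) -scalerA memvZ.
- by rewrite span_on_scale_head.
Qed.

End Symmetry.

Theorem theorem2p3 (R : realType) (n : nat) (U : set 'rV[R]_n)
    (w : form1 R n) (X : vfield R n) (f : 'rV[R]_n -> R)
    (Uopen : open U) (Ustar : star_shaped U)
    (wsmooth : smooth_on U w) (wnz : forall x, U x -> w x != 0)
    (wfrob : frobenius_integrable U w)
    (Xsym : Coo_symmetry U (kernel_distribution U w) X)
    (fsmooth : smooth_on U f) (fnz : nonvanishing_on U f) :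
  symmetrizing_factor U (kernel_distribution U w) X f <->
  integrating_factor U w (fun x => (interior_prod (scale_field f X) w x)^-1).
Proof.
have [r [Z [Zgen XZ]]] := Xsym.
have YZ := Coo_symmetry_gen_scale Uopen fsmooth fnz XZ.
have [Ys YZfree _] := YZ.
have h0 : nonvanishing_on U (interior_prod (scale_field f X) w).
  by move=> x Ux; exact: (interior_prod_neq0 Uopen wsmooth wnz Zgen YZfree Ux).
have mus := smooth_onV Uopen h0 (smooth_on_interior_prod Uopen Ys wsmooth).
(* A symmetry comes with its own generators [Z'], possibly other than those of X; closedness is
   derived from these directly, without comparing the two families. *)
split=> [[_ _ [r' [Z' [Z'gen YZ']]]]|muw].
  split=> [|x Ux|]; [exact: mus|by rewrite invr_neq0 ?h0|].
  apply: (poincare Uopen Ustar (smooth_on_scale Uopen mus wsmooth)).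
  exact: (symmetry_closed Uopen wsmooth wnz wfrob Z'gen YZ').
split; [exact: fsmooth|exact: fnz|exists r, Z; split; first exact: Zgen].
apply: (integrating_factor_symmetry Uopen wsmooth Zgen YZ muw) => x Ux.
by rewrite mulVf// h0.
Qed.
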